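(* Let $G = N \rtimes H$ be a finite group with $N$ abelian, let $\mathcal{L}$ be a lattice of subgroups of $H$ satisfying (L1)--(L4), and for each $\psi\in\mathrm{Irr}(N)$ let $H_\psi\in\mathcal{L}$ be chosen so that (H1)--(H4) hold (these conditions are spelled out in the context). For $\psi\in\mathrm{Irr}(N)$ put $$S_\psi=\{\mathrm{Ind}_{H_\psi}^{I_H(\psi)}(\chi)\mid \chi \text{ is a supercharacter of } H_\psi\}.$$ Let $S$ be a set of orbit representatives of $\mathrm{Irr}(N)$ under the conjugation action of $G$. Then the set of characters $$\mathrm{SCh}(\mathcal{L})=\{\psi\rtimes\chi\mid \psi\in S \text{ and } \chi\in S_\psi\}$$ is the set of supercharacters of a supercharacter theory of $G$.
   Context: **Supercharacter theories.** A supercharacter theory of a finite group $G$ is a pair $(\mathcal{K},\mathcal{X})$, where $\mathcal{K}$ is a partition of $G$ into unions of conjugacy classes and $\mathcal{X}$ is a set of characters of $G$, such that $|\mathcal{X}|=|\mathcal{K}|$, each $\chi\in\mathcal{X}$ is constant on the blocks of $\mathcal{K}$, and each irreducible character of $G$ is a constituent of exactly one element of $\mathcal{X}$. Elements of $\mathcal{X}$ are supercharacters, blocks of $\mathcal{K}$ are superclasses; a superclass function is a function constant on the superclasses. **Notation.** ${}^hg=hgh^{-1}$, $g^h=h^{-1}gh$, and similarly ${}^hK$, $K^h$ for subgroups; for a function $\alpha$, $\alpha^h(x)=\alpha(hxh^{-1})$. For $\psi\in\mathrm{Irr}(N)$, $I_H(\psi)$ is the stabilizer of $\psi$ in $H$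 under conjugation. If $K$ is a subgroup of $I_H(\psi)$ and $\chi$ is a character of $K$, then $\psi\rtimes\chi=\mathrm{Ind}_{NK}^G(\vartheta)$, where $\vartheta$ is the character of $NK$ given by $\vartheta(nk)=\psi(n)\chi(k)$ for $n\in N$, $k\in K$. **Conditions on $\mathcal{L}$.** $\mathcal{L}$ is a set of subgroups of $H$ closed under the meet (intersection) and join (generated subgroup) of the subgroup lattice, and: (L1) $H$ and $\{1\}$ are in $\mathcal{L}$; (L2) if $K\in\mathcal{L}$ and $h\in H$, then ${}^hK\in\mathcal{L}$; (L3) each $K\in\mathcal{L}$ is equipped with a supercharacter theory; (L4) for $K_1\subseteq K_2$ in $\mathcal{L}$, induction from $K_1$ to $K_2$ and restriction from $K_2$ to $K_1$ send superclass functions to superclass functions, and conjugate subgroups have conjugate supercharacter theories: if $\chi$ is a supercharacter of $K\in\mathcal{L}$ and $g\in H$, then $\chi^g$ is a supercharacter of $K^g$. **Conditions on the $H_\psi\in\mathcal{L}$.** (H1) $H_\psi$ is a normal subgroup of $I_H(\psi)$; (H2) $H_{(\psi^h)}=(H_\psi)^h$ for all $h\in H$; (H3) $H_{1_N}=H$, where $1_N$ is the trivial character of $N$; (H4) $H_\psi\cap H_\varphi\subseteq H_{\psi\varphi}$ for all $\psi,\varphi\in\mathrm{Irr}(N)$. *)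

(* Defs.v *)
From HB Require Import structures.
From mathcomp Require Import all_boot all_order all_algebra all_fingroup.
From mathcomp Require Import all_solvable all_field all_character.
From mathcomp Require Import finmap.

Set Implicit Arguments.
Unset Strict Implicit.
Unset Printing Implicit Defensive.

Import GroupScope GRing.Theory.
Local Open Scope ring_scope.

Definition superclass_fun (gT : finGroupType) (G : {group gT})
    (KK : {set {set gT}}) (phi : 'CF(G)) : Prop :=
  {in KK, forall B : {set gT}, {in B &, forall x y, phi x = phi y}}.

(* 0 belongs to [character], so it has to be excluded from X explicitly:
   otherwise X = {0, regular character} would be allowed together with
   the partition {1}, G \ {1}. *)
Record supercharacter_theory (gT : finGroupType) (G : {group gT})
    (KK : {set {set gT}}) (X : {fset 'CF(G)}) : Prop := SupercharacterTheory {
  sct_partition : partition KK G;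
  sct_classes : {in KK, forall B, exists2 C : {set {set gT}},
                   C \subset classes G & B = cover C};
  sct_character : {in X, forall chi, chi \is a character /\ chi != 0};
  sct_card : #|` X| = #|KK|;
  sct_constant : {in X, forall chi, superclass_fun KK chi};
  sct_constituent : forall i : Iirr G,
    exists! chi : 'CF(G), chi \in X /\ i \in irr_constt chi }.

(* The conjugate of a class function on K, as a class function on K ^ g;
   [cfConjg] of the library stays on K and is only meaningful for g in 'N(K). *)
Definition cf_conj (gT : finGroupType) (K : {group gT}) (chi : 'CF(K)) (g : gT) :
    'CF(K :^ g) :=
  cfIsom (conj_isom K g) chi.

Lemma cf_conjE (gT : finGroupType) (K : {group gT}) (chi : 'CF(K)) (g x : gT) :
  x \in K :^ g -> cf_conj chi g x = chi (g * x * g^-1)%g.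
Proof.
case/imsetP=> y Ky ->; rewrite -[LHS]/(cf_conj chi g (conjgm K g y)).
by rewrite /cf_conj cfIsomE // conjgE !mulgA mulgV mul1g mulgK.
Qed.

Record L_conditions (gT : finGroupType) (H : {group gT})
    (L : {set {group gT}}) (KL : {group gT} -> {set {set gT}})
    (XL : forall K : {group gT}, {fset 'CF(K)}) : Prop := LConditions {
  L_sub : {in L, forall K : {group gT}, K \subset H};
  L_meet : {in L &, forall K1 K2 : {group gT}, (K1 :&: K2)%G \in L};
  L_join : {in L &, forall K1 K2 : {group gT}, (K1 <*> K2)%G \in L};
  L1 : H \in L /\ 1%G \in L;
  L2 : {in L & H, forall (K : {group gT}) h, (K :^ h^-1)%G \in L};
  L3 : {in L, forall K : {group gT}, supercharacter_theory (KL K) (XL K)};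
  L4_ind : {in L &, forall K1 K2 : {group gT}, K1 \subset K2 ->
    forall phi : 'CF(K1),
      superclass_fun (KL K1) phi -> superclass_fun (KL K2) ('Ind[K2] phi)};
  L4_res : {in L &, forall K1 K2 : {group gT}, K1 \subset K2 ->
    forall phi : 'CF(K2),
      superclass_fun (KL K2) phi -> superclass_fun (KL K1) ('Res[K1] phi)};
  L4_conj : {in L & H, forall (K : {group gT}) g, {in XL K, forall chi,
    cf_conj chi g \in XL (K :^ g)%G}} }.

(* Hs psi stands for H_psi; only its values on irr N matter. *)
Record H_conditions (gT : finGroupType) (N H : {group gT})
    (L : {set {group gT}}) (Hs : 'CF(N) -> {group gT}) : Prop := HConditions {
  H_in_L : {in irr N, forall psi, Hs psi \in L};
  H1 : {in irr N, forall psi, Hs psi <| 'I_H[psi]};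
  H2 : {in irr N & H, forall psi h, Hs (psi ^ h)%CF = (Hs psi :^ h)%G};
  H3 : Hs 1 = H;
  H4 : {in irr N &, forall psi phi, Hs psi :&: Hs phi \subset Hs (psi * phi)} }.

(* The class function n * k |-> psi n * chi k on NK. The formula uses the
   factorisation x = divgr N K x * remgr N K x; [insubd] returns 0 when it does
   not define a class function, which does not happen when N is abelian and
   K is a subgroup of the stabiliser of psi (cf_theta_mul below). *)
Definition cf_theta (gT : finGroupType) (N K : {group gT})
    (psi : 'CF(N)) (chi : 'CF(K)) : 'CF(N <*> K) :=
  insubd (0 : 'CF(N <*> K))
    [ffun x => if x \in N <*> K
               then psi (divgr N K x) * chi (remgr N K x) else 0].

Lemma cf_theta_mul (gT : finGroupType) (N H K : {group gT})
    (psi : 'CF(N)) (chi : 'CF(K)) :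
  abelian N -> H \subset 'N(N) -> N :&: H = 1%g -> psi \in irr N ->
  K \subset 'I_H[psi] ->
  {in N & K, forall n k, cf_theta psi chi (n * k)%g = psi n * chi k}.
Proof.
move=> cNN nNH tiNH irr_psi; rewrite subsetI => /andP[sKH sKI] n k Nn Kk.
have nNK := subset_trans sKH nNH.
have tiNK : N :&: K = 1%g.
  by apply/trivgP; rewrite -tiNH setIS.
have lin_psi : psi \is a linear_char.
  have /irrP[i ->] := irr_psi.
  by have /char_abelianP := cNN; apply.
have thetaE m y : m \in N -> y \in K ->
    psi (divgr N K (m * y)%g) * chi (remgr N K (m * y)%g) = psi m * chi y.
  by move=> Nm Ky; rewrite divgrMid // remgrMid.
pose f : {ffun gT -> algC} := [ffun x => if x \in N <*> K
                      then psi (divgr N K x) * chi (remgr N K x) else 0].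
have fE m y : m \in N -> y \in K -> f (m * y)%g = psi m * chi y.
  by move=> Nm Ky; rewrite ffunE norm_joinEr // mem_mulg // thetaE.
have psiJ m y : m \in N -> y \in K -> psi (m ^ y)%g = psi m.
  move=> Nm Ky; have := subsetP sKI y Ky; rewrite inE => /andP[nNy /eqP psi_y].
  by rewrite -{1}psi_y cfConjgEJ.
have f_class : is_class_fun <<N <*> K>> f.
  rewrite genGid /f; apply: intro_class_fun => [x z|x]; last first.
    by move/negbTE->.
  move=> NKx NKz; rewrite groupJ // NKx.
  move: NKx NKz; rewrite /= norm_joinEr // => /mulsgP[m y Nm Ky ->].
  case/mulsgP=> m' y' Nm' Ky' ->.
  have -> : ((m * y) ^ (m' * y') = (m * (m'^-1 * m' ^ y^-1)) ^ y' * y ^ y')%g.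
    rewrite conjgM -conjMg; congr (_ ^ _)%g.
    rewrite conjgE [(m' ^ _)%g]conjgE invgK !mulgA mulgKV.
    by rewrite (centsP cNN _ _ m) ?groupV.
  have Nm'y : (m' ^ y^-1)%g \in N.
    by rewrite memJ_norm // groupV (subsetP nNK).
  have Nmm : (m * (m'^-1 * m' ^ y^-1))%g \in N.
    by apply: groupM => //; apply: groupM; rewrite ?groupV.
  have NmJ : ((m * (m'^-1 * m' ^ y^-1)) ^ y')%g \in N.
    by rewrite memJ_norm // (subsetP nNK).
  rewrite (thetaE _ _ NmJ) ?groupJ // (thetaE _ _ Nm Ky).
  have psi_m' : psi (m' ^ y^-1)%g = psi m' by rewrite psiJ ?groupV.
  have Vm' : m'^-1%g \in N by rewrite groupV.
  rewrite (psiJ _ _ Nmm Ky') (lin_charM lin_psi Nm (groupM Vm' Nm'y)).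
  rewrite (lin_charM lin_psi Vm' Nm'y) psi_m' -(lin_charM lin_psi Vm' Nm').
  rewrite mulVg (lin_char1 lin_psi) mulr1.
  by rewrite cfunJ.
rewrite -fE // /cf_theta -/f.
by have := insubdK (0 : 'CF(N <*> K)) f_class => /(congr1 (fun g : {ffun _} => g (n * k)%g)).
Qed.

Definition cf_rtimes (gT : finGroupType) (G N K : {group gT})
    (psi : 'CF(N)) (chi : 'CF(K)) : 'CF(G) :=
  'Ind[G] (cf_theta psi chi).

Definition orbit_representatives (gT : finGroupType) (G N : {group gT})
    (S : {fset 'CF(N)}) : Prop :=
  {subset S <= irr N} /\
  {in irr N, forall psi, exists! phi, phi \in S /\ phi \in (psi ^: G)%CF}.

Definition S_psi (gT : finGroupType) (N H : {group gT})
    (XL : forall K : {group gT}, {fset 'CF(K)}) (Hs : 'CF(N) -> {group gT})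
    (psi : 'CF(N)) : {fset 'CF('I_H[psi])} :=
  [fset 'Ind['I_H[psi]] chi | chi in XL (Hs psi)]%fset.

Definition SCh (gT : finGroupType) (G N H : {group gT})
    (XL : forall K : {group gT}, {fset 'CF(K)}) (Hs : 'CF(N) -> {group gT})
    (S : {fset 'CF(N)}) : {fset 'CF(G)} :=
  [fset cf_rtimes G psi chi | psi in S, chi in S_psi H XL Hs psi]%fset.

(* Main.v *)
Require Import Defs.
From HB Require Import structures.
From mathcomp Require Import all_boot all_order all_algebra all_fingroup.
From mathcomp Require Import all_solvable all_field all_character.
From mathcomp Require Import finmap.

Set Implicit Arguments.
Unset Strict Implicit.
Unset Printing Implicit Defensive.

Import GroupScope GRing.Theory Num.Theory.
Local Open Scope ring_scope.

(* For f a class function on G, psi in Irr(N) and h in H, let f_psi(h) be the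
   psi-coefficient of n |-> f(nh). The span of SCh is the space A of all f such
   that every f_psi is a superclass function of H_psi extended by zero: the
   coefficients of psi ><| chi are the H-conjugates of chi, placed on the orbit
   of psi, and f is determined by the f_psi with psi in S. A pointwise
   product convolves the coefficients, so (H4) and (L4) make A closed under products,
   and (H3) gives 1 in A. The elements of SCh have disjoint sets of irreducible
   constituents covering Irr(G), so they form a basis of A; the superclasses are
   the sets on which A is constant, and there are dim A of them since their
   indicator functions lie in A. *)

(** * Indicator functions of the superclasses *)

Section Blocks.

Variables (gT : finGroupType) (G : {group gT}) (KK : {set {set gT}}).
Hypothesis partKK : partition KK G.
Hypothesis classesKK :
  {in KK, forall B, exists2 C : {set {set gT}}, C \subset classes G & B = cover C}.

Let tiKK : trivIset KK. Proof. by case/and3P: partKK. Qed.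
Let coverKK : cover KK = G. Proof. by case/and3P: partKK => /eqP. Qed.

(** The relation [<|] is used here for a plain subset of G: it is the condition under which [cfuniE]
    evaluates ['1_B] as membership in [B]. *)
Lemma block_normal B : B \in KK -> B <| G.
Proof.
case/classesKK=> C sCG ->; apply/andP; split.
  by apply/bigcupsP=> A /(subsetP sCG)/imsetP[x Gx ->]; rewrite class_subG.
apply/subsetP=> g Gg; rewrite inE; apply/subsetP=> _ /imsetP[x /bigcupP[A CA Ax] ->].
apply/bigcupP; exists A => //.
have /(subsetP sCG)/imsetP[y Gy defA] := CA.
by move: Ax; rewrite defA => /imsetP[z Gz ->]; rewrite -conjgM memJ_class ?groupM.
Qed.

Definition block_cfuns : seq 'CF(G) := [seq '1_B | B : {set gT} <- enum KK].

Lemma size_block_cfuns : size block_cfuns = #|KK|.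
Proof. by rewrite size_map -cardE. Qed.


Lemma superclass_fun_span (f : 'CF(G)) :
  superclass_fun KK f -> f \in <<block_cfuns>>%VS.
Proof.
move=> f_const; suff ->: f = \sum_(B in KK) f (repr B) *: '1_B.
  apply: memv_suml => B KB; apply/memvZ/memv_span/map_f.
  by rewrite mem_enum.
apply/cfun_inP=> x Gx; have /bigcupP[B KB Bx] : x \in cover KK by rewrite coverKK.
rewrite sum_cfunE (bigD1 B) //= cfunE cfuniE ?block_normal // Bx mulr1.
rewrite big1 ?addr0 => [|C /andP[KC neqCB]].
  by apply: (f_const B); rewrite ?(mem_repr x).
rewrite cfunE cfuniE ?block_normal //.
case: (boolP (x \in C)) => [Cx | _]; last by rewrite mulr0.
by rewrite -(def_pblock tiKK KB Bx) (def_pblock tiKK KC Cx) eqxx in neqCB.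
Qed.

(** Indicators of disjoint nonempty sets are nonzero and pairwise orthogonal. *)
Lemma block_cfuns_free : free block_cfuns.
Proof.
have cfunK B : B \in KK -> exists2 x, x \in B & x \in G.
  move=> KB; have /set0Pn[x Bx] : B != set0.
    by apply: contraTneq KB => ->; case/and3P: partKK.
  by exists x => //; rewrite -coverKK; apply/bigcupP; exists B.
have inj1 : {in KK &, injective (fun B => '1_B : 'CF(G))}.
  move=> B C KB KC /cfunP eqBC; have [x Bx _] := cfunK B KB.
  have := eqBC x; rewrite !cfuniE ?block_normal // Bx => /esym/eqP.
  rewrite pnatr_eq1 eqb1 => Cx.
  by rewrite -(def_pblock tiKK KB Bx) (def_pblock tiKK KC Cx).
apply/orthogonal_free/pairwise_orthogonalP; split.
  rewrite /= map_inj_in_uniq ?enum_uniq ?andbT => [|B C]; last first.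
    by rewrite !mem_enum; apply: inj1.
  apply/mapP=> [[B]]; rewrite mem_enum => KB /cfunP.
  have [x Bx _] := cfunK B KB => /(_ x)/eqP.
  by rewrite cfuniE ?block_normal // Bx cfunE eq_sym oner_eq0.
move=> _ _ /mapP[B + ->] /mapP[C + ->]; rewrite !mem_enum => KB KC neqBC.
rewrite cfdot_cfuni ?block_normal //.
have /eqP-> : B :&: C == set0; last by rewrite cards0 mul0r.
rewrite setI_eq0; have /trivIsetP tiK := tiKK; apply: tiK => //.
by apply: contraNneq neqBC => ->.
Qed.

End Blocks.

(** * Supercharacter theories through the span of their supercharacters *)

Section SupercharacterTheory.

Variables (gT : finGroupType) (G : {group gT}).
Implicit Types (X : {fset 'CF(G)}).

Lemma common_constt (chi xi : 'CF(G)) :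
  '[chi, xi] != 0 -> exists2 i, i \in irr_constt chi & i \in irr_constt xi.
Proof.
move=> nz; have [/exists_inP[i]|none] :=
    boolP [exists i in irr_constt chi, i \in irr_constt xi]; first by exists i.
case/eqP: nz; rewrite cfdot_sum_irr big1 // => i _; apply/eqP.
rewrite mulf_eq0 conjC_eq0; apply: contraNT none.
by rewrite negb_or -!irr_consttE => /andP[i1 i2]; apply/exists_inP; exists i.
Qed.

Lemma constt_orthogonal X :
    (forall i : Iirr G, exists! chi : 'CF(G), chi \in X /\ i \in irr_constt chi) ->
  {in X &, forall chi xi, chi != xi -> '[chi, xi] = 0}.
Proof.
move=> consttX chi xi Xchi Xxi; apply: contraNeq => /common_constt[i i1 i2].
have [phi [_ uniq_phi]] := consttX i.
by rewrite -(uniq_phi chi) // -(uniq_phi xi).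
Qed.

Lemma constt_free X :
    {in X, forall chi : 'CF(G), chi \is a character /\ chi != 0} ->
    (forall i : Iirr G, exists! chi : 'CF(G), chi \in X /\ i \in irr_constt chi) ->
  free X.
Proof.
move=> charX consttX; apply/orthogonal_free/pairwise_orthogonalP; split.
  rewrite /= fset_uniq andbT; apply/negP=> /charX[_]; by rewrite eqxx.
exact: constt_orthogonal.
Qed.

Lemma span_superclass_fun (KK : {set {set gT}}) X :
    {in X, forall chi, superclass_fun KK chi} ->
  {in <<X>>%VS, forall f, superclass_fun KK f}.
Proof.
move=> constX f /(@coord_span _ _ _ (in_tuple X))-> B KB x y Bx By.
rewrite !sum_cfunE; apply: eq_bigr => i _; rewrite !cfunE; congr (_ * _).
by apply: (constX _ _ B) => //; apply: mem_nth.
Qed.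

(** The supercharacters are orthogonal, hence free, and lie in the span of the block indicators.
    There are as many of them as blocks, so the two spans agree by dimension. *)
Lemma sct_span KK X :
  supercharacter_theory KK X ->
  forall f : 'CF(G), superclass_fun KK f <-> f \in <<X>>%VS.
Proof.
case=> partKK classesKK charX cardX constX consttX.
have freeX := constt_free charX consttX.
have sXB : (<<X>> <= <<block_cfuns G KK>>)%VS.
  by apply/span_subvP=> chi /constX; apply: superclass_fun_span.
have eqXB : <<X>>%VS = <<block_cfuns G KK>>%VS.
  apply/eqP; rewrite eqEdim sXB (eqP freeX) cardX -(size_block_cfuns G KK).
  exact: dim_span.
move=> f; split; first by rewrite eqXB; apply: superclass_fun_span.
exact: span_superclass_fun.
Qed.

(* The indicator functions of the sets on which all elements of X are constant
   are polynomials in the elements of X. *)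
Lemma sct_of_subalgebra X :
    {in X, forall chi : 'CF(G), chi \is a character /\ chi != 0} ->
    (forall i : Iirr G, exists! chi : 'CF(G), chi \in X /\ i \in irr_constt chi) ->
    1 \in <<X>>%VS -> {in <<X>>%VS &, forall f g, f * g \in <<X>>%VS} ->
  exists KK, supercharacter_theory KK X.
Proof.
move=> charX consttX X1 Xmul; have freeX := constt_free charX consttX.
(* The vector [v x] records the values at x of all elements of [X], so the blocks of [KK] are the
   joint level sets of [X]. *)
pose v x := [seq (chi : 'CF(G)) x | chi <- X].
have eq_v x y : reflect {in X, forall chi : 'CF(G), chi x = chi y} (v x == v y).
  apply: (iffP eqP) => [/eq_in_map//|eq_xy]; exact/eq_in_map.
pose KK := preim_partition v G; exists KK.
have partKK : partition KK G by apply: preim_partitionP.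
have [/eqP coverKK tiKK _] := and3P partKK.
have memKK B x y : B \in KK -> x \in B -> (y \in B) = (y \in G) && (v x == v y).
  move=> KB Bx; have Gx : x \in G by rewrite -coverKK; apply/bigcupP; exists B.
  case: (boolP (y \in G)) => [Gy|]; last first.
    by move=> nGy; apply: contraNF nGy => By; rewrite -coverKK; apply/bigcupP; exists B.
  rewrite -(def_pblock tiKK KB Bx) /KK /preim_partition pblock_equivalence_partition //.
  by split=> // /eqP->.
have KKG B : B \in KK -> {subset B <= G}.
  by move=> KB x Bx; rewrite -coverKK; apply/bigcupP; exists B.
have classesKK :
    {in KK, forall B, exists2 C : {set {set gT}}, C \subset classes G & B = cover C}.
  move=> B KB; exists [set x ^: G | x in B].
    by apply/subsetP=> _ /imsetP[x Bx ->]; rewrite mem_classes ?(KKG B KB).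
  apply/setP=> x; apply/idP/bigcupP=> [Bx | [_ /imsetP[y By ->] /imsetP[z Gz ->]]].
    by exists (x ^: G); [apply/imsetP; exists x | apply: class_refl].
  have Gy := KKG B KB y By; rewrite (memKK B y) // groupJ //=; apply/eq_v=> chi _.
  by rewrite cfunJ.
have constX : {in X, forall chi, superclass_fun KK chi}.
  by move=> chi Xchi B KB x y Bx; rewrite (memKK B x) // => /andP[_ /eq_v->].
have sepX B (s : seq gT) : B \in KK -> {subset s <= G :\: B} ->
    exists f : 'CF(G), [/\ f \in <<X>>%VS, {in B, forall x, f x = 1}
                         & {in s, forall x, f x = 0}].
  move=> KB; have /set0Pn[b Bb] : B != set0.
    by apply: contraTneq KB => ->; case/and3P: partKK.
  (* Each further point c outside [B] is handled by one more factor, built from an element of [X]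
     that separates c from b. *)
  elim: s => [|c s IHs] sGB.
    by exists 1; split=> // x Bx; rewrite cfun1E (KKG B KB).
  have [|f [Xf fB fs]] := IHs; first by move=> x sx; rewrite sGB // inE sx orbT.
  have /setDP[Gc nBc] := sGB c (mem_head _ _).
  have /allPn[chi Xchi neq_chi] : ~~ all (fun chi : 'CF(G) => chi b == chi c) X.
    apply: contra nBc => /allP eq_bc; rewrite (memKK B b) // Gc.
    by apply/eq_v=> chi /eq_bc/eqP.
  (* Normalised so that [q] is 1 at b, hence on all of [B], and 0 at c. *)
  pose q := (chi b - chi c)^-1 *: (chi - chi c *: 1).
  have Xq : q \in <<X>>%VS by rewrite memvZ // rpredB ?memvZ // memv_span.
  exists (f * q); split; first exact: Xmul.
    move=> x Bx; rewrite !cfunE fB // mul1r cfun1E (KKG B KB) // mulr1.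
    by rewrite (constX _ Xchi B KB x b) // mulVf // subr_eq0.
  move=> x; rewrite inE => /predU1P[->|/fs f0]; rewrite !cfunE; last first.
    by rewrite f0 mul0r.
  by rewrite cfun1E Gc mulr1 subrr !mulr0.
(* Both generating families are free, so this equality of spans also yields the cardinality
   condition. *)
have eqXB : <<X>>%VS = <<block_cfuns G KK>>%VS.
  apply/eqP; rewrite eqEsubv; apply/andP; split; apply/span_subvP.
    by move=> chi /constX; apply: superclass_fun_span.
  move=> _ /mapP[B + ->]; rewrite mem_enum => KB.
  have [|f [Xf fB f0]] := sepX B (enum (G :\: B)) KB.
    by move=> x; rewrite mem_enum.
  suff ->: '1_B = f by [].
  apply/cfun_inP=> x Gx; rewrite cfuniE ?(block_normal classesKK) //.
  have [/fB-> //|nBx] := boolP (x \in B).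
  by rewrite f0 // mem_enum inE nBx.
split=> //.
have freeB := block_cfuns_free partKK classesKK.
by rewrite -(size_block_cfuns G KK) -(eqP freeB) -eqXB (eqP freeX).
Qed.

End SupercharacterTheory.

(** * Fourier coefficients along the abelian normal subgroup N *)

Section PartialFourier.

Variables (gT : finGroupType) (G N H : {group gT}).
Hypotheses (defG : (N ><| H)%g = G) (abelN : abelian N).

Let nsNG : N <| G. Proof. by have [] := sdprod_context defG. Qed.
Let sHG : H \subset G. Proof. by have [] := sdprod_context defG. Qed.
Let defNH : (N * H)%g = G. Proof. by have [] := sdprod_context defG. Qed.
Let nNH : H \subset 'N(N). Proof. by have [] := sdprod_context defG. Qed.
Let tiNH : N :&: H = 1%g. Proof. by have [] := sdprod_context defG. Qed.

Lemma irr_lin (psi : 'CF(N)) : psi \in irr N -> psi \is a linear_char.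
Proof. by case/irrP=> i ->; have /char_abelianP := abelN; apply. Qed.

Lemma sum_sdprod (F : gT -> algC) :
  \sum_(g in G) F g = \sum_(n in N) \sum_(h in H) F (n * h)%g.
Proof.
have {1}<- : uncurry (@mulg gT) @: setX N H = G.
  by rewrite -[RHS]defNH; exact/esym/curry_imset2X.
rewrite pair_big_dep /= big_imset /=; last first.
  move=> [n h] [m k] /setXP[/= Nn Hh] /setXP[/= Nm Hk] eq_nh.
  have := congr1 (divgr N H) eq_nh; rewrite !divgrMid // => ->.
  by have := congr1 (remgr N H) eq_nh; rewrite !remgrMid // => ->.
by apply: eq_big => [[n h]|[n h]]; rewrite ?inE.
Qed.

(** A bare function of [h] and not a class function of H: [partial_fourierJ] makes it invariant
    under the stabiliser of [psi] only. *)
Definition partial_fourier (f : 'CF(G)) (psi : 'CF(N)) (h : gT) : algC :=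
  #|N|%:R^-1 * \sum_(n in N) f (n * h)%g * (psi n)^*.

Local Notation pf := partial_fourier.
Implicit Types (f : 'CF(G)) (psi : 'CF(N)) (h : gT).

Lemma partial_fourier0 psi h : pf 0 psi h = 0.
Proof. by rewrite /pf big1 ?mulr0 // => n _; rewrite cfunE mul0r. Qed.

Lemma partial_fourierD (f1 f2 : 'CF(G)) psi h :
  pf (f1 + f2) psi h = pf f1 psi h + pf f2 psi h.
Proof.
rewrite /pf -mulrDr -big_split /=; congr (_ * _); apply: eq_bigr => n _.
by rewrite cfunE mulrDl.
Qed.

Lemma partial_fourierZ a f psi h : pf (a *: f) psi h = a * pf f psi h.
Proof.
rewrite /pf mulrCA [in RHS]mulr_sumr; congr (_ * _); apply: eq_bigr => n _.
by rewrite cfunE mulrA.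
Qed.

Lemma partial_fourier_sum (I : Type) (r : seq I) (P : pred I) (F : I -> 'CF(G))
    psi h :
  pf (\sum_(i <- r | P i) F i) psi h = \sum_(i <- r | P i) pf (F i) psi h.
Proof.
elim/big_rec2: _ => [|i y f _ <-]; first exact: partial_fourier0.
by rewrite partial_fourierD.
Qed.

(** Second orthogonality in N, where classes are singletons and centralisers are all of N, so that
    only the term m = n survives. *)
Lemma fourier_inversion f n h :
  n \in N -> f (n * h)%g = \sum_i pf f 'chi_i h * 'chi_i n.
Proof.
move=> Nn; pose F m := #|N|%:R^-1 * f (m * h)%g * \sum_i 'chi[N]_i n * ('chi_i m)^*.
have FE m : m \in N -> F m = f (m * h)%g *+ (m == n).
  move=> Nm; rewrite /F second_orthogonality_relation //.
  have -> : 'C_N[n] = N by apply/setIidPl; rewrite sub_cent1 (subsetP abelN).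
  have -> : m ^: N = [set m] by apply/abelian_classP.
  rewrite inE eq_sym; case: eqP => _; last by rewrite !mulr0n mulr0.
  by rewrite !mulr1n mulrAC mulVf ?mul1r ?neq0CG.
transitivity (\sum_(m in N) F m).
  rewrite (bigD1 n) //= FE // eqxx big1 ?addr0 // => m /andP[Nm /negPf neq_mn].
  by rewrite FE // neq_mn.
transitivity (\sum_(m in N) \sum_i
    #|N|%:R^-1 * (f (m * h)%g * ('chi[N]_i m)^*) * 'chi_i n).
  apply: eq_bigr => m _; rewrite /F mulr_sumr; apply: eq_bigr => i _.
  by rewrite -!mulrA; congr (_ * (_ * _)); rewrite mulrC.
rewrite exchange_big /=; apply: eq_bigr => i _.
by rewrite /pf mulr_sumr mulr_suml.
Qed.

(** Since f is invariant under G, conjugating the summation variable moves [psi] and [h] together.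
    This carries coefficients along H-orbits of characters. *)
Lemma partial_fourierJ f psi h g :
  g \in H -> pf f (psi ^ g)%CF (h ^ g)%g = pf f psi h.
Proof.
move=> Hg; rewrite /pf (reindex_inj (conjg_inj g)) /=; congr (_ * _).
apply: eq_big => [n | n _]; first by rewrite memJ_norm // (subsetP nNH).
by rewrite -conjMg cfunJ ?(subsetP sHG) // cfConjgEJ // (subsetP nNH).
Qed.

(** Expand [f1] by Fourier inversion and absorb each ['chi_i] into the character paired with [f2];
    it enters conjugated because [pf] conjugates its character. *)
Lemma partial_fourierM (f1 f2 : 'CF(G)) psi h :
  pf (f1 * f2) psi h = \sum_i pf f1 'chi_i h * pf f2 (('chi_i)^*%CF * psi) h.
Proof.
rewrite /pf (eq_bigr (fun n =>
    \sum_i pf f1 'chi_i h * (f2 (n * h)%g * ('chi_i n * (psi n)^*)))).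
  rewrite exchange_big mulr_sumr; apply: eq_bigr => i _ /=.
  rewrite -mulr_sumr mulrCA; congr (_ * (_ * _)); apply: eq_bigr => n _.
  by rewrite !cfunE rmorphM /= conjCK.
move=> n Nn; rewrite cfunE fourier_inversion // -mulrA mulr_suml.
by apply: eq_bigr => i _; rewrite -mulrA; congr (_ * _); rewrite mulrCA.
Qed.

Lemma partial_fourier1 psi h :
  psi \in irr N -> h \in H -> pf 1 psi h = (psi == 1)%:R.
Proof.
case/irrP=> j -> Hh; transitivity '['chi_0, 'chi[N]_j].
  rewrite /pf cfdotE; congr (_ * _); apply: eq_bigr => n Nn.
  have Gn := subsetP (normal_sub nsNG) n Nn; have Gh := subsetP sHG h Hh.
  by rewrite irr0 !cfun1E Nn groupM.
by rewrite cfdot_irr eq_sym -irr_eq1.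
Qed.

(** The set S represents G-orbits, but N fixes every class function of N, so an element of H already
    reaches the representative. *)
Lemma orbit_representative (S : {fset 'CF(N)}) psi :
    orbit_representatives G S -> psi \in irr N ->
  exists2 g, g \in H & (psi ^ g)%CF \in S.
Proof.
case=> _ Sorb irr_psi.
have [phi [[Sphi /cfclassP[x Gx def_phi]] _]] := Sorb psi irr_psi.
have [n [g [Nn Hg def_x _]]] := mem_sdprod defG Gx.
exists g => //; have [nNg nNn] := (subsetP nNH g Hg, subsetP (normG N) n Nn).
by rewrite def_phi def_x cfConjgMnorm // [(psi ^ n)%CF]cfConjg_id in Sphi.
Qed.

Lemma partial_fourier_inj (S : {fset 'CF(N)}) (f1 f2 : 'CF(G)) :
    orbit_representatives G S ->
    {in S, forall psi, {in H, pf f1 psi =1 pf f2 psi}} ->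
  f1 = f2.
Proof.
move=> Srep eqS.
suff eqpf psi : psi \in irr N -> {in H, pf f1 psi =1 pf f2 psi}.
  apply/cfun_inP=> x /(mem_sdprod defG)[n [h [Nn Hh -> _]]].
  by rewrite !fourier_inversion //; apply: eq_bigr => i _; rewrite eqpf ?mem_irr.
move=> irr_psi h Hh; have [g Hg Spsi] := orbit_representative Srep irr_psi.
rewrite -(partial_fourierJ f1 psi h Hg) -(partial_fourierJ f2 psi h Hg).
by apply: eqS => //; rewrite groupJ.
Qed.

End PartialFourier.

Local Notation pf := partial_fourier.

(** * The induced characters psi ><| eta and their Fourier coefficients *)

Section Rtimes.

Variables (gT : finGroupType) (G N H : {group gT}).
Hypotheses (defG : (N ><| H)%g = G) (abelN : abelian N).

Let nsNG : N <| G. Proof. by have [] := sdprod_context defG. Qed.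
Let sNG : N \subset G. Proof. exact: normal_sub. Qed.
Let sHG : H \subset G. Proof. by have [] := sdprod_context defG. Qed.
Let nNH : H \subset 'N(N). Proof. by have [] := sdprod_context defG. Qed.
Let tiNH : N :&: H = 1%g. Proof. by have [] := sdprod_context defG. Qed.

Lemma mem_inertia (psi : 'CF(N)) g :
  (g \in 'I_H[psi]) = (g \in H) && (psi ^ g == psi)%CF.
Proof.
rewrite in_setI; apply: andb_id2l => Hg.
by rewrite in_set (subsetP nNH).
Qed.

Section Stabiliser.

Variables (J : {group gT}) (psi : 'CF(N)).
Hypotheses (irr_psi : psi \in irr N) (sJI : J \subset 'I_H[psi]).
Implicit Types (eta : 'CF(J)) (f : 'CF(G)).

Let sJH : J \subset H. Proof. by rewrite (subset_trans sJI) ?subsetIl. Qed.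
Let defNJ : (N ><| J)%g = N <*> J.
Proof.
apply: sdprodEY; first exact: subset_trans nNH.
by apply/trivgP; rewrite -tiNH setIS.
Qed.
Let sNJG : N <*> J \subset G. Proof. by rewrite join_subG sNG (subset_trans sJH). Qed.

(** As psi is linear and J-invariant, nk |-> psi(n) is a one-dimensional representation of NJ. The
    function theta is its product with the inflation of [eta] along NJ -> J. *)
Lemma cf_theta_char eta : eta \is a character -> cf_theta psi eta \is a character.
Proof.
move=> char_eta; have lin_psi := irr_lin abelN irr_psi.
pose lam : 'CF(N <*> J) := cf_theta psi (1 : 'CF(J)).
have lamE n k : n \in N -> k \in J -> lam (n * k)%g = psi n.
  by move=> Nn Jk; rewrite (cf_theta_mul _ abelN nNH tiNH) // cfun1E Jk mulr1.
have lam_repr : mx_repr (N <*> J) (fun x => (lam x)%:M : 'M_1).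
  split=> [|x y NJx NJy]; first by rewrite -[1%g]mulg1 lamE ?group1 // lin_char1.
  have [n [k [Nn Jk -> _]]] := mem_sdprod defNJ NJx.
  have [m [l [Nm Jl -> _]]] := mem_sdprod defNJ NJy.
  have nNk : k^-1%g \in 'N(N) by rewrite groupV (subsetP nNH) ?(subsetP sJH).
  have -> : (n * k * (m * l) = (n * m ^ k^-1) * (k * l))%g.
    by rewrite conjgE invgK !mulgA mulgKV.
  have Nmk : (m ^ k^-1)%g \in N by rewrite memJ_norm.
  have Ik : k^-1%g \in 'I[psi] by rewrite groupV; have /setIP[] := subsetP sJI k Jk.
  rewrite !lamE ?(groupM Nn Nmk) ?(groupM Jk Jl) // lin_charM // inertia_valJ //.
  by rewrite scalar_mxM.
suff -> : cf_theta psi eta = cfRepr (MxRepresentation lam_repr) * cfSdprod defNJ eta.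
  by rewrite rpredM ?cfRepr_char ?cfSdprod_char.
apply/cfun_inP=> x NJx; have [n [k [Nn Jk def_x _]]] := mem_sdprod defNJ NJx.
rewrite !cfunE NJx mxtrace_scalar /= def_x lamE // cfSdprodE //.
by rewrite (cf_theta_mul _ abelN nNH tiNH).
Qed.

Lemma cf_rtimes_char eta :
  eta \is a character -> cf_rtimes G psi eta \is a character.
Proof. by move=> char_eta; apply/cfInd_char/cf_theta_char. Qed.

(** For h outside J both sides vanish: uniqueness of the factorisation in NH keeps nh out of NJ. *)
Lemma cf_theta_split eta n h :
  n \in N -> h \in H -> cf_theta psi eta (n * h)%g = psi n * eta h.
Proof.
move=> Nn Hh; have [Jh | nJh] := boolP (h \in J).
  exact: (cf_theta_mul _ abelN nNH tiNH).
rewrite [eta h]cfun0 // mulr0 cfun0 //; apply: contra nJh => NJnh.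
have [m [k [Nm Jk eq_nh _]]] := mem_sdprod defNJ NJnh.
have Hk := subsetP sJH k Jk; have /(congr1 (remgr N H)) := eq_nh.
by rewrite !remgrMid // => ->.
Qed.

Lemma cf_rtimesE eta n h : n \in N -> h \in H ->
  cf_rtimes G psi eta (n * h)%g =
    #|J|%:R^-1 * \sum_(g in H) psi (n ^ g)%g * eta (h ^ g)%g.
Proof.
move=> Nn Hh; rewrite /cf_rtimes cfIndE //=.
(* After inversion the N-part of the conjugating element acts last, where theta absorbs it as a
   class function of NJ. The resulting |N| equal terms cancel the factor |N| of |NJ|. *)
rewrite (reindex_inj invg_inj) /= (eq_bigl _ _ (fun x => groupV G x)).
rewrite (sum_sdprod defG) (eq_bigr (fun=> \sum_(g in H) psi (n ^ g)%g * eta (h ^ g)%g)).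
  rewrite sumr_const -(sdprod_card defNJ) natrM invfM -[X in _ * X]mulr_natl.
  by rewrite mulrACA mulVf ?mul1r ?neq0CG.
move=> m Nm; rewrite [RHS](reindex_inj invg_inj) /=; apply: eq_big => [g|g Hg].
  by rewrite groupV.
have NJm : m^-1%g \in N <*> J by apply: (subsetP (joing_subl N J)); rewrite groupV.
have Hgi : g^-1%g \in H by rewrite groupV.
have Nng : (n ^ g^-1)%g \in N by rewrite memJ_norm // (subsetP nNH).
by rewrite invMg conjgM (cfunJ (cf_theta psi eta)) // conjMg cf_theta_split // groupJ.
Qed.

(** Once the sums are exchanged, the sum over N is the inner product of [psi] with [phi ^ g], which
    is 1 or 0 as these irreducible characters agree or not. *)
Lemma partial_fourier_rtimes eta (phi : 'CF(N)) h : phi \in irr N -> h \in H ->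
  pf (cf_rtimes G psi eta) phi h =
    #|J|%:R^-1 * \sum_(g in H | psi == (phi ^ g)%CF) eta (h ^ g)%g.
Proof.
case/irrP=> i -> Hh; rewrite /pf big_mkcondr /=.
transitivity (#|N|%:R^-1 * \sum_(n in N) \sum_(g in H)
    #|J|%:R^-1 * (eta (h ^ g)%g * (psi (n ^ g)%g * ('chi_i n)^*))).
  congr (_ * _); apply: eq_bigr => n Nn.
  rewrite cf_rtimesE // -mulrA mulr_suml mulr_sumr.
  by apply: eq_bigr => g _; rewrite mulrAC [_ * eta _]mulrC.
rewrite exchange_big mulr_sumr mulr_sumr; apply: eq_bigr => g Hg.
rewrite -!mulr_sumr mulrCA; congr (_ * _); rewrite mulrCA.
have nNg := subsetP nNH g Hg.
have -> : #|N|%:R^-1 * \sum_(n in N) psi (n ^ g)%g * ('chi_i n)^* = '[psi, 'chi_i ^ g].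
  rewrite cfdotE [in RHS](reindex_inj (conjg_inj g)) /=; congr (_ * _).
  apply: eq_big => [n | n _]; first by rewrite memJ_norm.
  by rewrite cfConjgEJ.
have [k ->] := irrP irr_psi.
rewrite -conjg_IirrE cfdot_irr (inj_eq irr_inj); case: eqP; by rewrite ?mulr1 ?mulr0.
Qed.

(** Frobenius reciprocity moves the product to NJ, and summing over N first leaves the conjugated
    coefficient of f. *)
Lemma cfdot_rtimes eta f :
  '[cf_rtimes G psi eta, f] = #|J|%:R^-1 * \sum_(h in J) eta h * (pf f psi h)^*.
Proof.
rewrite -Frobenius_reciprocity cfdotE (sum_sdprod defNJ) exchange_big /=.
rewrite -(sdprod_card defNJ) natrM invfM -mulrA mulrCA; congr (_ * _).
rewrite mulr_sumr; apply: eq_bigr => h Jh.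
have Hh := subsetP sJH h Jh.
have -> : (pf f psi h)^* = #|N|%:R^-1 * \sum_(n in N) psi n * (f (n * h)%g)^*.
  rewrite /pf rmorphM fmorphV rmorph_nat rmorph_sum; congr (_ * _).
  by apply: eq_bigr => n _; rewrite rmorphM /= conjCK mulrC.
rewrite mulrCA; congr (_ * _); rewrite mulr_sumr; apply: eq_bigr => n Nn.
rewrite cf_theta_split // cfResE //; first by rewrite mulrAC mulrC mulrA.
by rewrite -(sdprodW defNJ) mem_mulg.
Qed.

End Stabiliser.

Section Inertia.

Variable psi : 'CF(N).
Hypothesis irr_psi : psi \in irr N.
Implicit Types (eta : 'CF('I_H[psi])).

Lemma partial_fourier_rtimes_id eta h :
  h \in H -> pf (cf_rtimes G psi eta) psi h = eta h.
Proof.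
move=> Hh; rewrite partial_fourier_rtimes //.
rewrite (eq_big [in 'I_H[psi]] (fun=> eta h)) => [|g|g].
- by rewrite sumr_const -[X in _ * X]mulr_natl mulKf ?neq0CG.
- by rewrite mem_inertia eq_sym.
rewrite eq_sym -mem_inertia => Ig; by rewrite cfunJ.
Qed.

Lemma partial_fourier_rtimes_out eta (phi : 'CF(N)) h :
    phi \in irr N -> psi \notin (phi ^: H)%CF -> h \in H ->
  pf (cf_rtimes G psi eta) phi h = 0.
Proof.
move=> irr_phi out Hh; rewrite partial_fourier_rtimes // big1 ?mulr0 //.
by move=> g /andP[Hg /eqP def_psi]; case/cfclassP: out; exists g.
Qed.

End Inertia.

End Rtimes.


(** Mackey's formula for a normal subgroup; summing over all of I instead of over cosets of K
    accounts for the factor 1/|K|. *)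
Lemma cfRes_Ind_sum (gT : finGroupType) (I K : {group gT}) (chi : 'CF(K)) :
  K <| I ->
  'Res[K] ('Ind[I] chi) = #|K|%:R^-1 *: \sum_(y in I) (chi ^ y)%CF.
Proof.
case/andP=> sKI /subsetP nKI; apply/cfun_inP=> x Kx.
rewrite cfResE // cfIndE // cfunE sum_cfunE; congr (_ * _).
rewrite (reindex_inj invg_inj) /=; apply: eq_big => [y | y Iy]; first exact: groupV.
by rewrite cfConjgE // nKI // -groupV.
Qed.

(** * Superclass functions on the members of the lattice *)

Section Lattice.

Variables (gT : finGroupType) (H : {group gT}) (L : {set {group gT}}).
Variable KL : {group gT} -> {set {set gT}}.
Variable XL : forall K : {group gT}, {fset 'CF(K)}.
Hypothesis Lcond : L_conditions H L KL XL.

Lemma superclass_span (K : {group gT}) (phi : 'CF(K)) :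
  K \in L -> superclass_fun (KL K) phi <-> phi \in <<XL K>>%VS.
Proof. by move=> LK; apply: sct_span; apply: (L3 Lcond). Qed.

Lemma superclass_spanM (K : {group gT}) : K \in L ->
  {in <<XL K>>%VS &, forall phi psi, phi * psi \in <<XL K>>%VS}.
Proof.
move=> LK phi psi /(superclass_span phi LK) phiK /(superclass_span psi LK) psiK.
apply/superclass_span => // B KB x y Bx By.
by rewrite !cfunE (phiK B _ x y) // (psiK B _ x y).
Qed.

Lemma superclass_span1 (K : {group gT}) : K \in L -> (1 : 'CF(K)) \in <<XL K>>%VS.
Proof.
move=> LK; apply/superclass_span => // B KB x y Bx By.
have /and3P[/eqP defK _ _] := sct_partition (L3 Lcond LK).
have sBK z : z \in B -> z \in K by move=> Bz; rewrite -defK; apply/bigcupP; exists B.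
by rewrite !cfun1E !sBK.
Qed.

Lemma superclass_spanInd (K1 K2 : {group gT}) (phi : 'CF(K1)) :
    K1 \in L -> K2 \in L -> K1 \subset K2 -> phi \in <<XL K1>>%VS ->
  'Ind[K2] phi \in <<XL K2>>%VS.
Proof.
move=> LK1 LK2 sK12 /(superclass_span _ LK1) phiK; apply/superclass_span => //.
exact: (L4_ind Lcond).
Qed.

Lemma superclass_spanRes (K1 K2 : {group gT}) (phi : 'CF(K2)) :
    K1 \in L -> K2 \in L -> K1 \subset K2 -> phi \in <<XL K2>>%VS ->
  'Res[K1] phi \in <<XL K1>>%VS.
Proof.
move=> LK1 LK2 sK12 /(superclass_span _ LK2) phiK; apply/superclass_span => //.
exact: (L4_res Lcond).
Qed.

(** The target [K'] is a variable with an equation, so that it can be some [Hs phi] without a cast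
    between types of class functions. *)
Lemma superclass_span_conj (K K' : {group gT}) g (phi : 'CF(K)) :
    K \in L -> g \in H -> K' = (K :^ g)%G -> phi \in <<XL K>>%VS ->
  exists2 phi' : 'CF(K'), phi' \in <<XL K'>>%VS &
    {in K', forall x, phi' x = phi (x ^ g^-1)%g}.
Proof.
move=> LK Hg -> Kphi; exists (cf_conj phi g); last first.
  by move=> x Kx; rewrite cf_conjE // conjgE invgK mulgA.
rewrite (coord_span (X := in_tuple (XL K)) Kphi) /cf_conj linear_sum.
apply: memv_suml => i _; rewrite linearZ memvZ // memv_span //.
by apply: (L4_conj Lcond) => //; apply: mem_nth.
Qed.

Lemma supercharacter_conjg (K : {group gT}) g (chi : 'CF(K)) :
  K \in L -> g \in H -> g \in 'N(K) -> chi \in XL K -> (chi ^ g)%CF \in XL K.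
Proof.
move=> LK Hg nKg Xchi; have eqK : K = (K :^ g)%G by apply/val_inj/esym/normP.
suff [chi' Xchi' chi'E] : exists2 chi' : 'CF(K), chi' \in XL K &
    {in K, forall x, chi' x = chi (x ^ g^-1)%g}.
  suff -> : (chi ^ g)%CF = chi' by [].
  by apply/cfun_inP=> x Kx; rewrite cfConjgE // chi'E.
have := L4_conj Lcond LK Hg Xchi.
have : {in K :^ g, forall x, cf_conj chi g x = chi (x ^ g^-1)%g}.
  by move=> x Kx; rewrite cf_conjE // conjgE invgK mulgA.
(* Generalising the conjugate character leaves [K :^ g] free to be rewritten to [K] in its type. *)
move: (cf_conj chi g : 'CF((K :^ g)%G)); rewrite -[K :^ g]/(gval (K :^ g)%G) -eqK.
by move=> chi' ? ?; exists chi'.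
Qed.

End Lattice.

(** * The algebra A, its equality with the span of SCh, and the constituents *)

Section Main.

Variables (gT : finGroupType) (G N H : {group gT}).
Hypotheses (defG : (N ><| H)%g = G) (abelN : abelian N).
Variables (L : {set {group gT}}) (KL : {group gT} -> {set {set gT}}).
Variable XL : forall K : {group gT}, {fset 'CF(K)}.
Hypothesis Lcond : L_conditions H L KL XL.
Variable Hs : 'CF(N) -> {group gT}.
Hypothesis Hcond : H_conditions H L Hs.
Variable S : {fset 'CF(N)}.
Hypothesis Srep : orbit_representatives G S.

Let sHG : H \subset G. Proof. by have [] := sdprod_context defG. Qed.
Let nNH : H \subset 'N(N). Proof. by have [] := sdprod_context defG. Qed.
Let irrS psi : psi \in S -> psi \in irr N. Proof. by case: Srep => + _; apply. Qed.

Local Notation X := (SCh G H XL Hs S).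

(** Membership in the space A. Extension by zero is implicit, since an element of ['CF(Hs psi)]
    vanishes outside [Hs psi]. *)
Definition little_group_fun (f : 'CF(G)) : Prop :=
  {in irr N, forall psi, exists2 chi : 'CF(Hs psi), chi \in <<XL (Hs psi)>>%VS &
     {in H, pf f psi =1 chi}}.

Lemma Hs_sub psi : psi \in irr N -> Hs psi \subset H.
Proof. by move=> irr_psi; apply: (L_sub Lcond); apply: (H_in_L Hcond). Qed.

Lemma SChP T :
  reflect (exists2 psi, psi \in S & exists2 chi, chi \in XL (Hs psi) &
             T = cf_rtimes G psi ('Ind['I_H[psi]] chi))
          (T \in X).
Proof.
apply: (iffP idP) => [/imfset2P[psi Spsi [_ /imfsetP[chi Xchi ->] ->]] | ].
  by exists psi => //; exists chi.
case=> psi Spsi [chi Xchi ->]; apply/imfset2P; exists psi => //.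
by exists ('Ind['I_H[psi]] chi) => //; apply/imfsetP; exists chi.
Qed.

(** At psi the coefficient is the induced character: by (H1) it vanishes off H_psi and restricts
    there to a multiple of a sum of conjugates of [chi], which are supercharacters by (L4). Then
    (H2) and (L4) transport this along the orbit of psi. *)
Lemma little_group_fun_rtimes psi chi :
    psi \in irr N -> chi \in XL (Hs psi) ->
  little_group_fun (cf_rtimes G psi ('Ind['I_H[psi]] chi)).
Proof.
move=> irr_psi Xchi phi irr_phi; set K := Hs psi in chi Xchi *; set eta := 'Ind _.
have [/cfclassP[g Hg def_psi] | out] := boolP (psi \in (phi ^: H)%CF); last first.
  exists 0 => [|h Hh]; first exact: mem0v.
  by rewrite (partial_fourier_rtimes_out defG) // cfunE.
have LK : K \in L by apply: (H_in_L Hcond).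
have nsKI : K <| 'I_H[psi] by apply: (H1 Hcond).
have Hg' : g^-1%g \in H by rewrite groupV.
have def_phi : phi = (psi ^ g^-1)%CF by rewrite def_psi cfConjgK.
have Reta : 'Res[K] eta \in <<XL K>>%VS.
  rewrite /eta cfRes_Ind_sum // memvZ // memv_suml // => y Iy; have /setIP[Hy _] := Iy.
  rewrite memv_span // (supercharacter_conjg Lcond) //.
  exact: (subsetP (normal_norm nsKI)).
have := superclass_span_conj Lcond LK Hg' _ Reta.
move=> /(_ (Hs phi)) [|chi' Xchi' chi'E]; first by rewrite def_phi (H2 Hcond).
exists chi' => // h Hh.
rewrite -(partial_fourierJ defG _ _ _ Hg) -def_psi.
rewrite (partial_fourier_rtimes_id defG) ?groupJ //.
have memK : (h \in Hs phi) = ((h ^ g)%g \in K).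
  by rewrite def_phi (H2 Hcond) // mem_conjgV.
have [Kh | nKh] := boolP (h \in Hs phi); last first.
  by rewrite [RHS]cfun0 // (cfun_on0 (cfInd_normal _ nsKI)) // -memK.
by rewrite chi'E // invgK cfResE ?(normal_sub nsKI) // -memK.
Qed.

Lemma little_group_funM f1 f2 :
  little_group_fun f1 -> little_group_fun f2 -> little_group_fun (f1 * f2).
Proof.
move=> lf1 lf2 phi irr_phi; set M := Hs phi.
have LM : M \in L by apply: (H_in_L Hcond).
have sMI : M \subset 'I_H[phi] by apply/normal_sub/(H1 Hcond).
pose u i h := pf f1 'chi[N]_i h * pf f2 (('chi_i)^*%CF * phi) h.
(* The summands [u i] need not be class functions of M, but their sum is, and
   averaging [u i] over M amounts to inducing it to M from
   Hs 'chi_i :&: Hs ('chi_i^* * phi). *)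
have uP i : exists d : 'CF(M), d \in <<XL M>>%VS /\
    {in H, forall h, \sum_(y in M) u i (h ^ y)%g = d h}.
  set psi := 'chi_i; set psi' := (psi^*%CF * phi).
  have irr_psi : psi \in irr N by apply: mem_irr.
  have lin_psi := irr_lin abelN irr_psi.
  have irr_psi' : psi' \in irr N.
    by rewrite mul_lin_irr ?cfConjC_lin_char.
  have [a Xa aE] := lf1 psi irr_psi; have [b Xb bE] := lf2 psi' irr_psi'.
  have LK1 : Hs psi \in L by apply: (H_in_L Hcond).
  have LK2 : Hs psi' \in L by apply: (H_in_L Hcond).
  pose K := (Hs psi :&: Hs psi')%G; have LK : K \in L by apply: (L_meet Lcond).
  have sKM : K \subset M.
    (* (H4) gives the inclusion because psi * psi' = phi, as psi is linear. *)
    have /subset_trans := H4 Hcond irr_psi irr_psi'; apply.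
    by rewrite /psi' mulrA mul_conjC_lin_char // mul1r.
  pose c := 'Res[K] a * 'Res[K] b.
  have Xc : c \in <<XL K>>%VS.
    rewrite (superclass_spanM Lcond) // (superclass_spanRes Lcond) //.
      exact: subsetIl.
    exact: subsetIr.
  have uE h : h \in H -> u i h = c h.
    move=> Hh; rewrite /u aE // bE // /c cfunE.
    have [Kh | nKh] := boolP (h \in K).
      by rewrite !cfResE ?subsetIl ?subsetIr.
    rewrite [X in _ = X * _]cfun0 // mul0r; move: nKh; rewrite inE negb_and.
    by case/orP=> nKh; [rewrite (cfun0 a) ?mul0r | rewrite (cfun0 b) ?mulr0].
  exists (#|K|%:R *: 'Ind[M] c); split.
    by rewrite memvZ // (superclass_spanInd Lcond).
  move=> h Hh; rewrite cfunE cfIndE // mulVKf ?neq0CG //; apply: eq_bigr => y My.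
  by rewrite uE // groupJ // (subsetP (Hs_sub irr_phi)).
have [d dP] := fin_all_exists uP.
exists (#|M|%:R^-1 *: \sum_i d i).
  by rewrite memvZ // memv_suml // => i _; have [] := dP i.
(* The coefficient at phi is invariant under M, which lies in the stabiliser of phi, so it equals
   its own average over M. *)
move=> h Hh; transitivity (#|M|%:R^-1 * \sum_(y in M) pf (f1 * f2) phi (h ^ y)%g).
  rewrite (eq_bigr (fun=> pf (f1 * f2) phi h)) => [|y My].
    by rewrite sumr_const -[X in _ = _ * X]mulr_natl mulKf ?neq0CG.
  have /setIP[Hy Iy] := subsetP sMI y My.
  by rewrite -{1}(inertiaJ Iy) (partial_fourierJ defG).
rewrite cfunE sum_cfunE; congr (_ * _).
rewrite (eq_bigr (fun y => \sum_i u i (h ^ y)%g)) => [|y My].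
  by rewrite exchange_big /=; apply: eq_bigr => i _; have [_ ->] := dP i.
by rewrite (partial_fourierM abelN).
Qed.

Lemma little_group_fun1 : little_group_fun 1.
Proof.
move=> psi irr_psi; have [psi1 | psi1] := eqVneq psi 1; last first.
  exists 0; first exact: mem0v.
  by move=> h Hh; rewrite (partial_fourier1 defG) // cfunE (negPf psi1).
exists 1; first by apply: (superclass_span1 Lcond); apply: (H_in_L Hcond).
move=> h Hh; rewrite (partial_fourier1 defG) // psi1 eqxx cfun1E.
by rewrite (H3 Hcond) Hh.
Qed.

Lemma little_group_fun_span f : f \in <<X>>%VS -> little_group_fun f.
Proof.
move=> /(@coord_span _ _ _ (in_tuple X))->.
elim/big_ind: _ => [psi _ | f1 f2 lf1 lf2 psi irr_psi | i _ psi irr_psi].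
- exists 0; first exact: mem0v.
  by move=> h _; rewrite partial_fourier0 cfunE.
- have [[a Xa aE] [b Xb bE]] := (lf1 psi irr_psi, lf2 psi irr_psi).
  exists (a + b); first exact: memvD.
  by move=> h Hh; rewrite partial_fourierD cfunE aE // bE.
have /SChP[phi Sphi [chi Xchi ->]] : (in_tuple X)`_i \in X by apply: mem_nth.
have [a Xa aE] := little_group_fun_rtimes (irrS Sphi) Xchi irr_psi.
exists (coord (in_tuple X) i f *: a); first exact: memvZ.
by move=> h Hh; rewrite partial_fourierZ cfunE aE.
Qed.

Lemma S_disjoint psi phi :
  psi \in S -> phi \in S -> psi \in (phi ^: H)%CF -> psi = phi.
Proof.
move=> Spsi Sphi /cfclassP[g Hg def_psi].
have [_ /(_ phi (irrS Sphi))[xi [_ uniq_xi]]] := Srep.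
transitivity xi; first (apply/esym/uniq_xi; split=> //; apply/cfclassP).
  by exists g => //; apply: (subsetP sHG).
by apply: uniq_xi; split=> //; apply: cfclass_refl.
Qed.

Lemma partial_fourier_rtimes_neq psi phi (eta : 'CF('I_H[psi])) h :
    psi \in S -> phi \in S -> psi != phi -> h \in H ->
  pf (cf_rtimes G psi eta) phi h = 0.
Proof.
move=> Spsi Sphi neq Hh.
apply: (partial_fourier_rtimes_out defG) (irrS Sphi) _ Hh => //; first exact: irrS.
by apply: contra neq => /(S_disjoint Spsi Sphi)->.
Qed.

(** Isolates the part of f over the orbit of [psi]: expand the coefficient [a] at [psi] in
    supercharacters and take the same combination of elements of [SCh]. *)
Lemma little_group_fun_component f psi :
    little_group_fun f -> psi \in S ->
  exists2 g, g \in <<X>>%VS &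
    {in S & H, forall phi h, pf g phi h = pf f phi h *+ (phi == psi)}.
Proof.
move=> lf Spsi; have irr_psi := irrS Spsi; have [a Xa aE] := lf psi irr_psi.
set K := Hs psi in a Xa aE; pose I := ('I_H[psi])%G.
have sKI : K \subset I by apply/normal_sub/(H1 Hcond).
pose XK := in_tuple (XL K); pose T j := cf_rtimes G psi ('Ind['I_H[psi]] XK`_j).
pose g0 := \sum_(j < size (XL K)) coord XK j a *: T j.
(* The function [a] is already invariant under I, so inducing it from K to I multiplies it by
   |I|/|K|; the scalar undoes this. *)
exists ((#|K|%:R / #|I|%:R) *: g0).
  rewrite memvZ // memv_suml // => j _; rewrite memvZ // memv_span //.
  by apply/SChP; exists psi => //; exists (XK`_j) => //; apply: mem_nth.
move=> phi h Sphi Hh; rewrite partial_fourierZ partial_fourier_sum.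
have [-> | neq] := eqVneq; last first.
  rewrite big1 ?mulr0 // => j _.
  by rewrite partial_fourierZ partial_fourier_rtimes_neq ?mulr0 // eq_sym.
have -> : \sum_(j < size (XL K)) pf (coord XK j a *: T j) psi h = 'Ind['I_H[psi]] a h.
  rewrite {2}(coord_span (X := XK) Xa) linear_sum sum_cfunE; apply: eq_bigr => j _.
  by rewrite partial_fourierZ (partial_fourier_rtimes_id defG) // linearZ cfunE.
rewrite mulr1n cfIndE // [X in X * _ = _]mulrC -mulrA mulVKf ?neq0CG //.
rewrite (eq_bigr (fun=> pf f psi h)) => [|y /setIP[Hy Iy]].
  by rewrite sumr_const -[X in _ * X = _]mulr_natl mulKf ?neq0CG.
by rewrite -aE ?groupJ // -{1}(inertiaJ Iy) (partial_fourierJ defG).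
Qed.

Lemma little_group_fun_in_span f : little_group_fun f -> f \in <<X>>%VS.
Proof.
move=> lf.
(* Components are added one representative at a time; uniqueness of [s] prevents counting one
   twice. *)
suff: forall s : seq 'CF(N), uniq s -> {subset s <= S} ->
    exists g, g \in <<X>>%VS /\
      {in S & H, forall phi h, pf g phi h = pf f phi h *+ (phi \in s)}.
  case/(_ S (fset_uniq S)) => // g [Xg gE]; suff -> : f = g by [].
  apply: (partial_fourier_inj defG abelN Srep) => phi Sphi h Hh.
  by rewrite gE // Sphi.
elim=> [|psi s IHs] /=.
  exists 0; split; first exact: mem0v.
  by move=> phi h _ _; rewrite partial_fourier0.
case/andP=> nspsi /IHs{}IHs sS; have [|g [Xg gE]] := IHs.
  by move=> phi sphi; rewrite sS // inE sphi orbT.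
have [g' Xg' g'E] := little_group_fun_component lf (sS psi (mem_head _ _)).
exists (g + g'); split; first exact: memvD.
move=> phi h Sphi Hh; rewrite partial_fourierD gE // g'E // -mulrnDr inE.
by case: eqVneq => [->|_]; rewrite ?(negPf nspsi) ?addn0.
Qed.

Lemma SCh_char : {in X, forall T : 'CF(G), T \is a character /\ T != 0}.
Proof.
move=> T /SChP[psi Spsi [chi Xchi ->]]; have irr_psi := irrS Spsi.
have sctK := L3 Lcond (H_in_L Hcond irr_psi).
have [char_chi nz_chi] := sct_character sctK Xchi.
have sKI : Hs psi \subset 'I_H[psi] by apply/normal_sub/(H1 Hcond).
split; first by apply: (cf_rtimes_char defG) => //; apply: cfInd_char.
apply: contraNneq nz_chi => T0; rewrite -(cfInd_eq0 sKI) //.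
apply/eqP/cfun_inP=> h /setIP[Hh _].
by rewrite -(partial_fourier_rtimes_id defG) // T0 partial_fourier0 cfunE.
Qed.

(** A common constituent makes the inner product nonzero, which forces the same psi and then
    non-orthogonal characters induced from [chi] and [xi]. By Mackey some conjugate of [chi] under
    the stabiliser of psi is not orthogonal to [xi]; both are supercharacters, hence equal, and
    conjugate characters induce alike. *)
Lemma SCh_constt_uniq T1 T2 (i : Iirr G) :
  T1 \in X -> T2 \in X -> i \in irr_constt T1 -> i \in irr_constt T2 -> T1 = T2.
Proof.
move=> XT1 XT2 iT1 iT2.
have [[char1 _] [char2 _]] := (SCh_char XT1, SCh_char XT2).
have {iT1 iT2} : '[T1, T2] != 0.
  apply/eqP=> /(constt_ortho_char char1 char2 iT1 iT2)/eqP.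
  by rewrite cfnorm_irr oner_eq0.
have [[psi Spsi [chi Xchi ->]] [phi Sphi [xi Xxi ->]]] := (SChP _ XT1, SChP _ XT2).
have irr_psi := irrS Spsi.
rewrite (cfdot_rtimes defG abelN irr_psi (subxx _)).
have [eq_phi | neq] := eqVneq phi psi; last first.
  rewrite big1 ?mulr0 ?eqxx // => h /setIP[Hh _].
  by rewrite partial_fourier_rtimes_neq // conjC0 mulr0.
subst phi; move=> nz; suff eq_chi : exists2 y, y \in 'I_H[psi] & xi = (chi ^ y)%CF.
  have nsKI : Hs psi <| 'I_H[psi] by apply: (H1 Hcond).
  by congr (cf_rtimes G psi _); apply: cfclass_Ind => //; apply/cfclassP.
set K := Hs psi in chi Xchi xi Xxi XT1 XT2 char1 char2 nz *.
have LK : K \in L by apply: (H_in_L Hcond).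
have nsKI : K <| 'I_H[psi] by apply: (H1 Hcond).
have sctK := L3 Lcond LK.
have : '['Ind['I_H[psi]] chi, 'Ind['I_H[psi]] xi] != 0.
  apply: contraNneq nz => d0; apply/eqP; rewrite -[RHS]d0 cfdotE; congr (_ * _).
  by apply: eq_bigr => h /setIP[Hh _]; rewrite (partial_fourier_rtimes_id defG).
rewrite -cfdot_Res_l cfRes_Ind_sum // cfdotZl cfdot_suml mulf_eq0 negb_or.
case/andP=> _ nz_sum; have [/exists_inP[y Iy nz_y] | none] :=
  boolP [exists y in 'I_H[psi], '[chi ^ y, xi] != 0].
  exists y => //; have /setIP[Hy _] := Iy; apply: contraNeq nz_y => neq.
  rewrite (constt_orthogonal (sct_constituent sctK)) // 1?eq_sym //.
  by apply: (supercharacter_conjg Lcond) => //; apply: (subsetP (normal_norm nsKI)).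
case/eqP: nz_sum; apply: big1 => y Iy; apply/eqP.
by apply: contraNT none => nz_y; apply/exists_inP; exists y.
Qed.

(** If ['chi_i] occurred in no element of [SCh], pairing with it would annihilate every
    supercharacter of H_psi, hence by positivity every irreducible character, hence the regular one.
    This kills all coefficients at h = 1 and gives ['chi_i] degree 0. *)
Lemma SCh_constt_exists (i : Iirr G) : exists2 T, T \in X & i \in irr_constt T.
Proof.
have [/hasP[T XT iT] | /hasPn none] := boolP (has (fun T => i \in irr_constt T) X).
  by exists T.
suff pf0 psi : psi \in S -> pf 'chi_i psi 1%g = 0.
  case/eqP: (irr1_neq0 i); rewrite -[1%g]mulg1 (fourier_inversion abelN) //.
  apply: big1 => j _; apply/eqP; rewrite mulf_eq0; apply/orP; left.
  have [g Hg Sg] := orbit_representative defG Srep (mem_irr j).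
  by rewrite -(partial_fourierJ defG _ _ _ Hg) conj1g pf0.
move=> Spsi; have irr_psi := irrS Spsi; pose K := Hs psi.
have LK : K \in L by apply: (H_in_L Hcond).
have sctK := L3 Lcond LK.
have sKI : K \subset 'I_H[psi] by apply/normal_sub/(H1 Hcond).
pose ell (a : 'CF(K)) := '[cf_rtimes G psi ('Ind['I_H[psi]] a), 'chi_i].
have ellE a : ell a = #|'I_H[psi]|%:R^-1 *
    \sum_(h in 'I_H[psi]) 'Ind['I_H[psi]] a h * (pf 'chi_i psi h)^*.
  exact: (cfdot_rtimes defG abelN irr_psi (subxx _)).
have ell_sum (J : finType) (c : J -> algC) (a : J -> 'CF(K)) :
    ell (\sum_j c j *: a j) = \sum_j c j * ell (a j).
  rewrite ellE; under [RHS]eq_bigr do rewrite ellE mulrCA mulr_sumr.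
  rewrite -mulr_sumr exchange_big /=; congr (_ * _); apply: eq_bigr => h _.
  rewrite linear_sum sum_cfunE mulr_suml; apply: eq_bigr => j _.
  by rewrite linearZ cfunE mulrA.
have ell_ge0 a : a \is a character -> 0 <= ell a.
  move=> char_a; rewrite natr_ge0 // Cnat_cfdot_char_irr //.
  by apply: (cf_rtimes_char defG) => //; apply: cfInd_char.
have ell_irr j : ell 'chi_j = 0.
  have [chi [[Xchi jchi] _]] := sct_constituent sctK j.
  have [char_chi _] := sct_character sctK Xchi.
  have [rest char_rest def_chi] := constt_charP j char_chi jchi.
  have : ell chi = 0.
    have /none : cf_rtimes G psi ('Ind['I_H[psi]] chi) \in X.
      by apply/SChP; exists psi => //; exists chi.
    by rewrite irr_consttE negbK => /eqP.
  (* Additivity of [ell] on chi = chi_j + rest: two nonnegative terms with sum 0 both vanish. *)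
  have := ell_sum bool (fun=> 1) (fun b => if b then 'chi_j else rest).
  rewrite !big_bool /= !scale1r !mul1r -def_chi => -> /eqP.
  by rewrite paddr_eq0 ?ell_ge0 ?irr_char // => /andP[/eqP].
have := ell_sum _ (fun j => 'chi_j 1%g) (fun j => 'chi_j); rewrite -cfReg_sum.
rewrite big1 => [|j _]; last by rewrite ell_irr mulr0.
(* The character induced from the regular character of K is supported at 1, so only a nonzero
   multiple of the conjugate of [pf 'chi_i psi 1] remains. *)
rewrite ellE (bigD1 1%g) //= big1 ?addr0 => [|h /andP[Ih nt_h]]; last first.
  rewrite cfIndE // big1 ?mulr0 ?mul0r // => y _.
  by rewrite cfRegE conjg_eq1 (negPf nt_h).
rewrite cfInd1 // cfRegE eqxx => /eqP.
rewrite !mulf_eq0 invr_eq0 conjC_eq0 (negPf (neq0CiG _ _)) !(negPf (neq0CG _)).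
by move/eqP.
Qed.

Lemma SCh_supercharacter_theory : exists KK, supercharacter_theory KK X.
Proof.
apply: sct_of_subalgebra SCh_char _ _ _.
- move=> i; have [T XT iT] := SCh_constt_exists i.
  by exists T; split=> // T' [XT' iT']; apply: SCh_constt_uniq iT iT'.
- exact/little_group_fun_in_span/little_group_fun1.
move=> f g /little_group_fun_span lf /little_group_fun_span lg.
exact/little_group_fun_in_span/little_group_funM.
Qed.

End Main.

Theorem theorem4p2 (gT : finGroupType) (G N H : {group gT})
    (defG : (N ><| H)%g = G) (abelN : abelian N)
    (L : {set {group gT}}) (KL : {group gT} -> {set {set gT}})
    (XL : forall K : {group gT}, {fset 'CF(K)})
    (Lcond : L_conditions H L KL XL)
    (Hs : 'CF(N) -> {group gT}) (Hcond : H_conditions H L Hs)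
    (S : {fset 'CF(N)}) (Srep : orbit_representatives G S) :
  exists KK : {set {set gT}}, supercharacter_theory KK (SCh G H XL Hs S).
Proof. exact: (SCh_supercharacter_theory defG abelN Lcond Hcond Srep). Qed.
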